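(* Let $n\ge 1$ and $r\ge 0$. Then the inclusion $\iota\colon \mathcal{N}(\mathbb{I}_n,r)\hookrightarrow\mathcal{N}(\mathbb{I}_n,r+2)$ is homotopic to a constant map.
   Context: For a finite simple connected graph $G$ and a real number $r\ge 0$, the Čech complex $\mathcal{N}(G,r)$ is the simplicial complex with vertex set $V(G)$ in which a finite nonempty set $\sigma\subseteq V(G)$ is a simplex if and only if the closed balls of radius $\frac r2$ centered at the vertices of $\sigma$ have a common point, the balls being taken in the geometric realization of $G$ with the shortest path metric in which each edge is isometric to $[0,1]$; thus $\mathcal{N}(G,r)\subseteq\mathcal{N}(G,r')$ for $r\le r'$. The hypercube graph $\mathbb{I}_n$ has vertex set $\{0,1\}^n$, two vertices adjacent iff they differ in exactly one coordinate. *)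

(* Defs.v *)
From HB Require Import structures.
From mathcomp Require Import all_boot all_order all_algebra.
From mathcomp Require Import all_classical all_reals all_analysis.

Set Implicit Arguments.
Unset Strict Implicit.
Unset Printing Implicit Defensive.

Import Order.TTheory GRing.Theory Num.Theory.
Import numFieldNormedType.Exports.

Local Open Scope classical_set_scope.
Local Open Scope ring_scope.

(* Finite abstract simplicial complexes on the vertices V; simplices are
   nonempty. *)
Record scomplex (V : finType) := SComplex {
  simplex :> pred {set V};
  simplex_neq0 : forall s, simplex s -> s != finset.set0;
  simplex_sub : forall s t, simplex s -> t != finset.set0 -> t \subset s ->
    simplex t }.

Section Realization.
Variables (R : realType) (V : finType).

Definition supp (x : V -> R) : {set V} := [set v | x v != 0]%SET.

Definition realization_set (K : scomplex V) : set {ptws V -> R} :=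
  [set x | [/\ forall v, 0 <= x v, \sum_v x v = 1 & K (supp x)]].

(* The set of barycentric coordinates in R^V, with the subspace topology; this
   is the usual (coherent) topology because K is finite. *)
Definition realization (K : scomplex V) : topologicalType :=
  set_type (realization_set K).

Lemma realization_setS (K L : scomplex V) :
  (forall s, K s -> L s) -> realization_set K `<=` realization_set L.
Proof. by move=> KL x [x0 x1 Kx]; split=> //; exact: KL. Qed.

Definition realization_incl (K L : scomplex V) (KL : forall s, K s -> L s)
    (x : realization K) : realization L :=
  exist _ (\val x) (mem_set (realization_setS KL (set_mem (valP x)))).

Lemma supp_vertex (v : V) : supp (fun u => (u == v)%:R) = [set v]%SET.
Proof.
apply/setP => u; rewrite !inE.
by have [_|_] := eqVneq u v; rewrite ?oner_eq0 ?eqxx.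
Qed.

Lemma vertex_subproof (K : scomplex V) (v : V) : K [set v]%SET ->
  (fun u => (u == v)%:R) \in realization_set K.
Proof.
move=> Kv; apply: mem_set; split=> [u||]; first exact: ler0n.
- rewrite (bigD1 v) //= eqxx big1 ?addr0// => u /negPf -> //.
- by rewrite supp_vertex.
Qed.

Definition vertex (K : scomplex V) (v : V) (Kv : K [set v]%SET) :
  realization K := exist _ (fun u => (u == v)%:R) (vertex_subproof Kv).

End Realization.

Section Homotopy.
Variables (R : realType) (X Y : topologicalType).

Definition homotopic (f g : X -> Y) : Prop :=
  exists H : R * X -> Y,
    [/\ {within `[0, 1]%classic `*` [set: X], continuous H},
        forall x, H (0, x) = f x &
        forall x, H (1, x) = g x].

Definition nullhomotopic (f : X -> Y) : Prop :=
  exists y : Y, homotopic f (fun _ => y).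

End Homotopy.

Record cgraph := CGraph {
  vert :> finType;
  adj : rel vert;
  adj_sym : symmetric adj;
  adj_irr : irreflexive adj;
  adj_conn : forall u v, connect adj u v }.

Section GraphComplex.
Variable G : cgraph.

Definition graph_simplex : pred {set G} := fun s =>
  (0 < #|s| <= 2)%N &&
  [forall u in s, forall v in s, (u != v) ==> adj u v].

Lemma graph_simplex_neq0 s : graph_simplex s -> s != finset.set0.
Proof. by case/andP=> /andP[+ _] _; rewrite card_gt0. Qed.

Lemma graph_simplex_sub s t : graph_simplex s -> t != finset.set0 ->
  t \subset s -> graph_simplex t.
Proof.
move=> /andP[/andP[_ s2] sG] t0 ts; apply/andP; split.
  by rewrite card_gt0 t0 /= (leq_trans (subset_leq_card ts)).
apply/forall_inP => u ut; apply/forall_inP => v vt.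
by move/forall_inP: sG => /(_ u (fintype.subsetP ts u ut))/forall_inP;
  apply; exact: (fintype.subsetP ts).
Qed.

Definition graph_complex : scomplex G :=
  SComplex graph_simplex_neq0 graph_simplex_sub.

Lemma graph_simplex1 (v : G) : graph_complex [set v]%SET.
Proof.
rewrite /graph_complex /= /graph_simplex cards1 /=.
apply/forall_inP => a /finset.set1P->; apply/forall_inP => b /finset.set1P->.
by rewrite eqxx.
Qed.

End GraphComplex.

Section GraphMetric.
Variables (R : realType) (G : cgraph).

Definition grealization : topologicalType := realization R (graph_complex G).

Definition gcoord (x : grealization) : G -> R := \val x.

Definition gvertex (v : G) : grealization := vertex R (graph_simplex1 v).

Definition on_common_edge : rel grealization := fun x y =>
  graph_complex G (supp (gcoord x) :|: supp (gcoord y)).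

(* For x = (1 - s) u + s v and y = (1 - t) u + t v on an edge uv, this is
   `|s - t|, so that every edge is isometric to [0, 1]. *)
Definition segment_length (x y : grealization) : R :=
  2^-1 * \sum_v `|gcoord x v - gcoord y v|.

Fixpoint chain_length (x : grealization) (s : seq grealization) : R :=
  if s is y :: s' then segment_length x y + chain_length y s' else 0.

(* The shortest path metric: the infimum of the lengths of the piecewise linear
   paths x, s_0, ..., s_k = y in which consecutive points share an edge. *)
Definition gdist (x y : grealization) : \bar R :=
  ereal_inf [set (chain_length x s)%:E |
    s in [set s | path on_common_edge x s /\ last x s = y]].

Definition gball (x : grealization) (e : R) : set grealization :=
  [set y | (gdist x y <= e%:E)%E].

End GraphMetric.

Section Cech.
Variables (R : realType) (G : cgraph).

Definition cech_simplex (r : R) : pred {set G} := fun s =>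
  (s != finset.set0) &&
  `[< exists y, forall v, v \in s -> gball (gvertex R v) (r / 2) y >].

Lemma cech_simplex_neq0 r s : cech_simplex r s -> s != finset.set0.
Proof. by case/andP. Qed.

Lemma cech_simplex_sub r s t : cech_simplex r s -> t != finset.set0 ->
  t \subset s -> cech_simplex r t.
Proof.
move=> /andP[_ /asboolP[y sy]] t0 /fintype.subsetP ts.
by apply/andP; split=> //; apply/asboolP; exists y => v /ts; exact: sy.
Qed.

Definition cech (r : R) : scomplex G :=
  SComplex (@cech_simplex_neq0 r) (@cech_simplex_sub r).

Lemma cech_le (r r' : R) : r <= r' -> forall s, cech r s -> cech r' s.
Proof.
move=> rr' s /andP[s0 /asboolP[y sy]].
apply/andP; split=> //; apply/asboolP; exists y => v /sy /= /le_trans; apply.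
by rewrite lee_fin ler_pM2r// invr_gt0.
Qed.

Lemma cech_vertex (r : R) (v : G) : 0 <= r -> cech r [set v]%SET.
Proof.
move=> r0; apply/andP; split.
  by apply/set0Pn; exists v; rewrite finset.set11.
apply/asboolP; exists (gvertex R v) => _ /finset.set1P->.
apply: ge_ereal_inf; exists 0%E; last by rewrite lee_fin divr_ge0.
by exists [::].
Qed.

Definition cech_incl (r r' : R) (rr' : r <= r') :
    realization R (cech r) -> realization R (cech r') :=
  realization_incl (cech_le rr').

End Cech.

Arguments cech {R} G r.
Arguments cech_incl {R} G {r r'} rr' x.

Section Hypercube.
Variable n : nat.

Definition cube_adj : rel {ffun 'I_n -> bool} := fun x y =>
  #|[set i | x i != y i]%SET| == 1%N.

Lemma cube_adj_sym : symmetric cube_adj.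
Proof.
move=> x y; rewrite /cube_adj; congr (_ == _); apply: eq_card => i.
by rewrite !inE eq_sym.
Qed.

Lemma cube_adj_irr : irreflexive cube_adj.
Proof.
by move=> x; rewrite /cube_adj eq_card0// => i; rewrite !inE eqxx.
Qed.

Lemma cube_adj_conn x y : connect cube_adj x y.
Proof.
move: {-1}#|[set i | x i != y i]%SET| (erefl #|[set i | x i != y i]%SET|) => k.
elim: k x => [|k IH] x xyk.
  suff -> : x = y by exact: connect0.
  apply/ffunP => i; apply/eqP/negPn/negP => xyi.
  by move/cards0_eq/setP/(_ i): xyk; rewrite !inE xyi.
have /set0Pn[i] : [set i | x i != y i]%SET != finset.set0.
  by rewrite -card_gt0 xyk.
rewrite inE => xyi.
pose z := [ffun j => if j == i then y i else x j].
have xz : cube_adj x z.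
  rewrite /cube_adj (_ : [set j | _]%SET = [set i]%SET) ?cards1//.
  apply/setP => j; rewrite !inE ffunE.
  by case: (eqVneq j i) => [->//|_]; rewrite eqxx.
apply: connect_trans (connect1 xz) (IH _ _); apply/eqP; rewrite -eqSS -xyk.
rewrite [X in _ == X](cardsD1 i) inE xyi add1n eqSS; apply/eqP; apply: eq_card => j.
by rewrite !inE ffunE; case: (eqVneq j i) => [->|]; rewrite ?eqxx.
Qed.

Definition hypercube : cgraph :=
  CGraph cube_adj_sym cube_adj_irr cube_adj_conn.

End Hypercube.

Lemma ler_addr2 (R : realType) (r : R) : r <= r + 2.
Proof. by rewrite lerDl. Qed.

(* Main.v *)
Require Import Defs.
From mathcomp Require Import all_boot all_order all_algebra.
From mathcomp Require Import all_classical all_reals all_analysis.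
From mathcomp Require Import lra.

Set Implicit Arguments.
Unset Strict Implicit.
Unset Printing Implicit Defensive.

Import Order.TTheory GRing.Theory Num.Theory.
Import numFieldNormedType.Exports.

Local Open Scope classical_set_scope.
Local Open Scope ring_scope.

(* Let f_k reset the first k coordinates of a vertex of the cube to 0. Each f_k
   extends to a 1-Lipschitz self-map of the geometric realization of the cube,
   and f_k v, f_(k+1) v are at distance at most 1. Hence, if the simplex s lies
   in the ball of radius r/2 around y, then f_k s and f_(k+1) s both lie in the
   ball of radius r/2 + 1 around f_k y: f_k and f_(k+1) are contiguous as maps
   from N(r) to N(r + 2). This connects f_0 = id to the constant map f_n. *)

(** * Pushing barycentric coordinates forward along a vertex map *)

Section Pushforward.
Variables (R : realType) (V W : finType).
Implicit Types (f : V -> W) (x y : V -> R).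

(** The affine extension of [f] in barycentric coordinates: the weight at [v] moves to [f v]. *)
Definition push f x : W -> R := fun w => \sum_(v | f v == w) x v.

Lemma push_ge0 f x : (forall v, 0 <= x v) -> forall w, 0 <= push f x w.
Proof. by move=> x0 w; apply: sumr_ge0. Qed.

Lemma sum_push f x : \sum_w push f x w = \sum_v x v.
Proof.
by rewrite [RHS](partition_big f xpredT).
Qed.

Lemma supp_push f x : supp (push f x) \subset f @: supp x.
Proof.
apply/fintype.subsetP => w; rewrite inE /push => xw.
have [v /andP[/eqP <- xv]|h] := pickP (fun v => (f v == w) && (x v != 0)).
  by apply: imset_f; rewrite inE.
move: xw; rewrite big1 ?eqxx// => v fv.
by have := h v; rewrite fv /= => /negbFE/eqP.
Qed.

Lemma supp_neq0 x : \sum_v x v = 1 -> supp x != finset.set0.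
Proof.
move=> x1; apply/negP => /eqP x0; move: x1; rewrite big1; last first.
  by move=> v _; apply/eqP; move/setP/(_ v): x0; rewrite !inE => /negbFE.
by move/eqP; rewrite eq_sym oner_eq0.
Qed.

(** The triangle inequality on each fibre of [f]. *)
Lemma push_dist f x y :
  \sum_w `|push f x w - push f y w| <= \sum_v `|x v - y v|.
Proof.
rewrite [leRHS](partition_big f xpredT)//=; apply: ler_sum => w _.
by rewrite /push -sumrB; apply: ler_norm_sum.
Qed.

Lemma push_vertex f v :
  push f (fun u => (u == v)%:R) = (fun w => (w == f v)%:R :> R).
Proof.
apply: funext => w; rewrite /push big_mkcond (bigD1 v)//= eqxx big1 ?addr0.
  by rewrite eq_sym; case: (w == _).
by move=> u /negPf ->; case: ifP.
Qed.

Lemma push_const w x : \sum_v x v = 1 ->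
  push (fun=> w) x = (fun u => (u == w)%:R).
Proof.
move=> x1; apply: funext => u; rewrite /push eq_sym.
by case: eqP => // _; rewrite big_pred0.
Qed.

End Pushforward.

Lemma push_id (R : realType) (V : finType) (x : V -> R) : push id x = x.
Proof. by apply: funext => v; rewrite /push big_pred1_eq. Qed.

(** * Tent functions as a partition of unity *)

Section Hat.
Variable R : realType.
Implicit Types (s : R) (k m N : nat).

(** The tent of height 1 at [k], zero outside [[k - 1, k + 1]]: a weight of piecewise linear
    interpolation at the naturals. *)
Definition hat k s : R := Num.max 0 (1 - `|s - k%:R|).

Lemma hat_ge0 k s : 0 <= hat k s.
Proof. by rewrite le_max lexx. Qed.

(** A nonzero tent means [|s - k| < 1], hence [m - 1 < k < m + 2]. *)
Lemma hat_neq0 k m s : m%:R <= s < m.+1%:R -> hat k s != 0 ->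
  (k == m) || (k == m.+1).
Proof.
move=> /andP[ms sm] h.
have : `|s - k%:R| < 1.
  rewrite ltNge; apply: contra h => h.
  by rewrite /hat; apply/eqP/max_l; rewrite subr_le0.
rewrite ltr_norml => /andP[h1 h2].
have km : (k < m.+2)%N.
  rewrite -(ltr_nat R); move: sm; rewrite -(natr1 m.+1); lra.
have mk : (m < k.+1)%N by rewrite -(ltr_nat R) -natr1; lra.
by move: km; rewrite ltnS leq_eqVlt ltnS orbC [k == m]eqn_leq
  -[(m <= k)%N]ltnS mk andbT.
Qed.

Lemma hat_left m s : m%:R <= s < m.+1%:R -> hat m s = 1 - (s - m%:R).
Proof.
rewrite -natr1 => /andP[ms sm].
rewrite /hat max_r ger0_norm; lra.
Qed.

Lemma hat_right m s : m%:R <= s < m.+1%:R -> hat m.+1 s = s - m%:R.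
Proof.
rewrite /hat -natr1 => /andP[ms sm].
rewrite max_r ler0_norm; lra.
Qed.

Lemma hat_nat k m : hat k m%:R = (k == m)%:R.
Proof.
have mm : m%:R <= (m%:R : R) < m.+1%:R by rewrite lexx ltr_nat ltnSn.
have [->|km] := eqVneq k m; first by rewrite hat_left// subrr subr0.
apply/eqP/negPn/negP => h; have := hat_neq0 mm h.
rewrite (negPf km) /= => /eqP kE; move: h.
by rewrite kE hat_right// subrr eqxx.
Qed.

(** On [[m, m + 1)] only the tents at [m] and [m + 1] survive, with values [1 - (s - m)] and
    [s - m]. The sum includes the index [N + 1] because [s = N] gives [m = N]. *)
Lemma sum_hat N s : 0 <= s <= N%:R -> \sum_(k < N.+2) hat k s = 1.
Proof.
move=> /andP[s0 sN]; have ms := truncn_itv s0.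
set m := Num.trunc s in ms.
have mN : (m < N.+1)%N.
  by rewrite -(ltr_nat R) (le_lt_trans _ (_ : N%:R < _)) ?ltr_nat//
    (le_trans _ sN)//; case/andP: ms.
have mN2 : (m < N.+2)%N by rewrite ltnW.
rewrite (bigD1 (Ordinal mN2))//=.
rewrite (bigD1 (Ordinal (mN : m.+1 < N.+2)%N)) /=; last first.
  by rewrite -val_eqE /= gtn_eqF.
rewrite hat_left// hat_right// big1 ?addr0 ?subrK// => k /andP[k1 k2].
apply/eqP/negPn/negP => /(hat_neq0 ms).
by move: k1 k2; rewrite -!val_eqE /= => /negPf -> /negPf ->.
Qed.

Lemma continuous_hat k : continuous (hat k).
Proof.
move=> s; apply: (@continuous_max _ _ (fun=> 0) (fun s => 1 - `|s - k%:R|)).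
  exact: cvg_cst.
apply: cvgB; first exact: cvg_cst.
by apply: cvg_norm; apply: cvgB; [exact: cvg_id|exact: cvg_cst].
Qed.

End Hat.

(** * Continuity in coordinates *)

Section RealizationTopology.
Variables (R : realType) (V : finType) (K : scomplex V).

Lemma continuous_coord v :
  continuous (fun x : realization R K => (\val x : V -> R) v).
Proof.
move=> x.
apply: (@continuous_comp _ {ptws V -> R} _ (fun x : realization R K => \val x)
  (fun y => y v)); first exact: initial_continuous.
exact: (@proj_continuous V (fun=> R) v).
Qed.

(** The realization is a subspace of a product, so its coordinates detect continuity. *)
Lemma continuous_realization (X : topologicalType) (h : X -> realization R K) :
  (forall v, continuous (fun x => (\val (h x) : V -> R) v)) -> continuous h.
Proof.
move=> hc; apply: continuous_comp_initial => x.
apply/cvg_sup => v U [B [[C oC <-] /= Cx CU]].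
apply: filterS CU _; apply: (hc v x).
exact: open_nbhs_nbhs.
Qed.

End RealizationTopology.

(** * A chain of contiguous maps yields a homotopy *)

Section Contiguity.
Variables (R : realType) (V W : finType) (K : scomplex V) (L : scomplex W).
Variables (f : nat -> V -> W) (N : nat).
Hypothesis fP : forall k s, K s -> L (f k @: s :|: f k.+1 @: s)%SET.

(** Stretches [[0, 1]] onto [[0, N]] and is constant outside, so that the homotopy makes sense for
    every real [t]. *)
Let clamp (t : R) : R := N%:R * Num.min 1 (Num.max 0 t).

Let clamp_itv t : 0 <= clamp t <= N%:R.
Proof.
rewrite /clamp mulr_ge0//=; first by rewrite ler_piMr// ge_min lexx.
by rewrite le_min ler01 le_max lexx.
Qed.

Let continuous_clamp : continuous clamp.
Proof.
move=> t; apply: cvgM; first exact: cvg_cst.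
have max_cont : {for t, continuous (fun t : R => Num.max 0 t)}.
  by apply: (@continuous_max _ _ (fun=> 0) id); [exact: cvg_cst|exact: cvg_id].
have cst_cont : {for t, continuous (fun=> 1 : R)} by exact: cvg_cst.
exact: (continuous_min cst_cont max_cont).
Qed.

(** While [clamp t] runs through [[m, m + 1]], this traces the segment from [push (f m) x] to
    [push (f m.+1) x]. *)
Definition contiguity_fun (t : R) (x : V -> R) : W -> R :=
  fun w => \sum_(k < N.+2) hat k (clamp t) * push (f k) x w.

(** With [m] the integer part of [clamp t], only [f m] and [f m.+1] carry weight, so the support
    lies in the union of their images of [supp x], a simplex of [L] by [fP]. *)
Lemma contiguity_funP t x : realization_set K x ->
  realization_set L (contiguity_fun t x).
Proof.
move=> [x0 x1 Kx].
have h1 : \sum_w contiguity_fun t x w = 1.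
  rewrite exchange_big /= -(sum_hat (clamp_itv t)); apply: eq_bigr => k _.
  by rewrite -mulr_sumr sum_push x1 mulr1.
split=> // [w|].
  by apply: sumr_ge0 => k _; rewrite mulr_ge0 ?hat_ge0// push_ge0.
have [t0 _] := andP (clamp_itv t); have ms := truncn_itv t0.
set m := Num.trunc _ in ms.
apply: simplex_sub (fP m Kx) (supp_neq0 h1) _.
apply/fintype.subsetP => w; rewrite inE => hw.
have [k /= hk|h] :=
    pickP (fun k : 'I_N.+2 => hat k (clamp t) * push (f k) x w != 0).
  move: hk; rewrite mulf_eq0 negb_or => /andP[/(hat_neq0 ms) km kw].
  have wk : w \in (f k @: supp x).
    by apply: (fintype.subsetP (supp_push _ _)); rewrite inE.
  by rewrite inE; case/orP: km => /eqP <-; rewrite wk ?orbT.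
move: hw; rewrite /contiguity_fun big1 ?eqxx// => k _.
by apply/eqP/negbFE/h.
Qed.

Lemma contiguous_homotopic (g0 g1 : realization R K -> realization R L) :
  (forall x, \val (g0 x) = push (f 0) (\val x)) ->
  (forall x, \val (g1 x) = push (f N) (\val x)) ->
  homotopic R g0 g1.
Proof.
move=> g0E g1E.
pose H (p : R * realization R K) : realization R L :=
  exist _ (contiguity_fun p.1 (\val p.2))
    (mem_set (contiguity_funP p.1 (set_mem (valP p.2)))).
(* At an integer time a single tent is nonzero; this gives both ends of the homotopy. *)
have HE m t x : clamp t = m%:R -> (m <= N)%N ->
    \val (H (t, x)) = push (f m) (\val x).
  move=> tm mN; apply: funext => w; rewrite /= /contiguity_fun tm.
  have mN2 : (m < N.+2)%N by rewrite ltnS ltnW.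
  rewrite (bigD1 (Ordinal mN2))//= hat_nat eqxx mul1r big1 ?addr0// => k.
  by rewrite -val_eqE /= hat_nat => /negPf ->; rewrite mul0r.
exists H; split=> [|x|x]; last 2 first.
- by apply: val_inj; rewrite g0E (HE 0)// /clamp maxxx min_r ?mulr0.
- by apply: val_inj; rewrite g1E (HE N)// /clamp max_r// minxx mulr1.
(* Thanks to [clamp], continuity holds on the whole product, not only over [[0, 1]]. *)
apply: continuous_subspaceT; apply: continuous_realization => w.
apply: continuous_big; first exact: add_continuous.
move=> k _ p; apply: cvgM.
  apply: (@continuous_comp _ _ _ fst (fun t => hat k (clamp t))).
    exact: cvg_fst.
  by apply: continuous_comp; [exact: continuous_clamp|exact: continuous_hat].
have push_cont : continuous (fun x : realization R K => push (f k) (\val x) w).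
  apply: continuous_big; first exact: add_continuous.
  by move=> v _; exact: continuous_coord.
exact: (continuous_comp (@cvg_snd _ _ _ _ _) (push_cont p.2)).
Qed.

End Contiguity.

(** * Graph maps, the path metric and Čech complexes *)

Section Cech.
Variables (R : realType) (G : cgraph).
Implicit Types (f : G -> G) (x y z : grealization R G).

(** The reflexive closure of adjacency: a map preserving it may collapse an edge to a vertex. *)
Definition adjeq : rel G := fun u v => (u == v) || adj u v.

Lemma graph_simplex_imset f s : {homo f : u v / adjeq u v} ->
  graph_complex G s -> graph_complex G (f @: s).
Proof.
move=> fP /andP[/andP[s0 s2] sG]; apply/andP; split.
  rewrite (leq_trans (leq_imset_card _ _) s2) andbT.
  have /fintype.card_gt0P[v vs] := s0.
  by apply/fintype.card_gt0P; exists (f v); exact: imset_f.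
apply/forall_inP => _ /imsetP[u us ->]; apply/forall_inP => _ /imsetP[v vs ->].
apply/implyP => fuv; have /fP : adjeq u v.
  rewrite /adjeq; case: eqVneq => //= uv.
  by move/forall_inP: sG => /(_ u us)/forall_inP/(_ v vs); rewrite uv.
by rewrite /adjeq (negPf fuv).
Qed.

Section GraphMap.
Variable f : G -> G.
Hypothesis fP : {homo f : u v / adjeq u v}.

Lemma push_graphP x : realization_set (graph_complex G) (push f (gcoord x)).
Proof.
have [x0 x1 Gx] := set_mem (valP x); split; first exact: push_ge0.
  by rewrite sum_push.
apply: simplex_sub (graph_simplex_imset fP Gx) _ (supp_push _ _).
by apply: supp_neq0; rewrite sum_push.
Qed.

Definition gpush x : grealization R G :=
  exist _ (push f (gcoord x)) (mem_set (push_graphP x)).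

Lemma gpush_vertex v : gpush (gvertex R v) = gvertex R (f v).
Proof. by apply: val_inj; rewrite /= /gcoord /= push_vertex. Qed.

Lemma on_common_edge_gpush x y :
  on_common_edge x y -> on_common_edge (gpush x) (gpush y).
Proof.
rewrite /on_common_edge => /(graph_simplex_imset fP) xy.
apply: simplex_sub xy _ _.
  have /finset.set0Pn[v vx] : supp (gcoord (gpush x)) != finset.set0.
    by apply: supp_neq0; case: (push_graphP x).
  by apply/finset.set0Pn; exists v; rewrite inE vx.
by rewrite imsetU; apply: finset.setUSS; apply: supp_push.
Qed.

Lemma chain_length_gpush x s :
  chain_length (gpush x) (map gpush s) <= chain_length x s.
Proof.
elim: s x => //= y s IH x; apply: lerD => //.
by rewrite ler_pM2l ?invr_gt0//; apply: push_dist.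
Qed.

(** [gpush] carries each chain from [x] to [y] to a chain between the images that is no longer, so
    the infimum cannot grow. *)
Lemma gdist_gpush x y : (gdist (gpush x) (gpush y) <= gdist x y)%E.
Proof.
apply: le_ereal_inf_tmp => _ [s [xs sy] <-]; apply: ge_ereal_inf.
exists (chain_length (gpush x) (map gpush s))%:E; last first.
  by rewrite lee_fin chain_length_gpush.
exists (map gpush s) => //; split; last by rewrite last_map sy.
rewrite path_map; apply: sub_path xs => u v; exact: on_common_edge_gpush.
Qed.

End GraphMap.

(** Each chain from [y] to [z] extends to one from [x] by the segment [xy]. *)
Lemma gdist_edge x y z : on_common_edge x y ->
  (gdist x z <= (segment_length x y)%:E + gdist y z)%E.
Proof.
move=> xy; rewrite -leeBlDl//; apply: le_ereal_inf_tmp => _ [s [ys sz] <-].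
rewrite leeBlDl// -EFinD; apply: ge_ereal_inf.
exists (chain_length x (y :: s))%:E; last by [].
by exists (y :: s) => //; split=> //=; rewrite xy.
Qed.

Lemma on_common_edge_vertex (u v : G) : adjeq u v ->
  on_common_edge (gvertex R u) (gvertex R v).
Proof.
move=> uv; rewrite /on_common_edge /gcoord /= !supp_vertex.
apply/andP; split; first by rewrite cards2; case: eqP.
have sym : adjeq v u by rewrite /adjeq eq_sym adj_sym.
apply/forall_inP => a /set2P ha; apply/forall_inP => b /set2P hb.
apply/implyP => ab; move: uv sym; rewrite /adjeq.
by case: ha hb ab => -> [] ->; rewrite ?eqxx// => /negPf ->.
Qed.

(** The coordinate vectors of two vertices have [l^1] distance at most 2, which the factor [2^-1]
    halves. *)
Lemma segment_length_vertex (u v : G) :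
  segment_length (gvertex R u) (gvertex R v) <= 1.
Proof.
rewrite /segment_length ler_pdivrMl// mulr1.
have sum1 (w : G) : \sum_a ((a == w)%:R : R) = 1.
  by rewrite (bigD1 w)//= eqxx big1 ?addr0// => a /negPf ->.
apply: (@le_trans _ _ (\sum_a ((a == u)%:R + (a == v)%:R))).
  apply: ler_sum => a _; apply: le_trans (ler_normB _ _) _.
  by rewrite !normr_nat.
by rewrite big_split /= !sum1.
Qed.

(* Both images lie in the ball of radius r/2 + 1 around the image under f of a
   common point of the r/2-balls. *)
Lemma cech_contiguous (r : R) f g s : {homo f : u v / adjeq u v} ->
  (forall v, adjeq (g v) (f v)) -> cech G r s ->
  cech G (r + 2) (f @: s :|: g @: s)%SET.
Proof.
move=> fP fg /andP[/finset.set0Pn[v vs] /asboolP[y sy]]; apply/andP; split.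
  by apply/finset.set0Pn; exists (f v); rewrite inE imset_f.
have fy u : u \in s -> (gdist (gvertex R (f u)) (gpush fP y) <= (r / 2)%:E)%E.
  by move=> us; rewrite -(gpush_vertex fP) (le_trans (gdist_gpush _ _ _))// sy.
have rE : (r + 2) / 2 = 1 + r / 2 by lra.
apply/asboolP; exists (gpush fP y) => _ /setUP[] /imsetP[u us ->] /=;
  rewrite /gball /= rE.
  by apply: le_trans (fy u us) _; rewrite lee_fin lerDr.
apply: le_trans (gdist_edge _ (on_common_edge_vertex (fg u))) _.
by rewrite EFinD leeD ?fy// lee_fin segment_length_vertex.
Qed.

(** [f 0] induces the inclusion, [f N] the constant map at the vertex [c], and [cech_contiguous]
    links consecutive maps. *)
Lemma cech_incl_nullhomotopic (r : R) (f : nat -> G -> G) (N : nat) (c : G) :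
  0 <= r -> f 0 =1 id -> (forall v, f N v = c) ->
  (forall k, {homo f k : u v / adjeq u v}) ->
  (forall k v, adjeq (f k.+1 v) (f k v)) ->
  nullhomotopic R (cech_incl G (ler_addr2 r)).
Proof.
move=> r0 f0 fN fP fS.
have r2 : 0 <= r + 2 by rewrite addr_ge0.
exists (vertex R (cech_vertex c r2)).
apply: (@contiguous_homotopic R _ _ _ _ f N) => [k s|x|x].
- exact: cech_contiguous.
- by rewrite (_ : f 0%N = id) ?push_id//; apply: funext.
- rewrite (_ : f N = fun=> c); last exact: funext.
  by rewrite push_const//; case: (set_mem (valP x)).
Qed.

End Cech.

(** * Collapsing the cube coordinate by coordinate *)

Section CubeCollapse.
Variable n : nat.
Implicit Types x y : hypercube n.

Definition collapse (k : nat) x : hypercube n :=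
  [ffun i : 'I_n => (k <= i)%N && x i].

Lemma cube_adjeq x y : adjeq x y = (#|[set i | x i != y i]%SET| <= 1)%N.
Proof.
rewrite leq_eqVlt ltnS leqn0 orbC /adjeq; congr (_ || _).
rewrite cards_eq0; apply/eqP/eqP => [->|/setP xy].
  by apply/setP => i; rewrite !inE eqxx.
by apply/ffunP => i; have := xy i; rewrite !inE => /negbFE/eqP.
Qed.

(** Resetting coordinates only shrinks the set where two vertices differ. *)
Lemma collapse_adjeq k : {homo collapse k : x y / adjeq x y}.
Proof.
move=> x y; rewrite !cube_adjeq; apply: leq_trans.
apply/subset_leq_card/fintype.subsetP => i; rewrite !inE !ffunE.
by case: (k <= i)%N.
Qed.

(** The two images can differ only at coordinate [k], and coincide when [k >= n]. *)
Lemma collapseS_adjeq k x : adjeq (collapse k.+1 x) (collapse k x).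
Proof.
rewrite cube_adjeq; apply/card_le1_eqP => i j; rewrite !inE !ffunE => hi hj.
suff kE (l : 'I_n) : (k < l)%N && x l != (k <= l)%N && x l -> l = k :> nat.
  by apply: val_inj; rewrite /= (kE i)// (kE j).
by rewrite [(k <= l)%N]leq_eqVlt; case: (eqVneq k l) => [->//|_]; rewrite eqxx.
Qed.

End CubeCollapse.

Theorem theorem6p1 (R : realType) (n : nat) (r : R) :
  (1 <= n)%N -> 0 <= r ->
  nullhomotopic R (cech_incl (hypercube n) (ler_addr2 r)).
Proof.
move=> _ r0; apply: (cech_incl_nullhomotopic (f := @collapse n) (N := n)
  (c := [ffun=> false])) => // [x|x||].
- by apply/ffunP => i; rewrite ffunE.
(* Every index is below [n], so the [n]-th collapse resets all coordinates. *)
- by apply/ffunP => i; rewrite !ffunE leqNgt ltn_ord.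
- exact: collapse_adjeq.
- exact: collapseS_adjeq.
Qed.
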